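(* Let $(X_m)_{m\ge 1}$ be a sequence of real random variables on a probability space and let $(\mathcal F_m)_{m\ge 0}$ be a filtration such that $X_1,\dots,X_m$ are $\mathcal F_m$-measurable for every $m$ (i.e. $\mathcal F_m\subseteq\mathcal F_{m+1}$ and $E(X_{m'}|\mathcal F_m)=X_{m'}$ for $m'\le m$). Suppose that $0\le X_m\le 1$ for every $m$. Then for every integer $n\ge 1$, every $a\in\mathbb R$ with $1+\frac{4a}{3\sqrt n}\neq 0$ and every real $b\ge 0$, $$P\left(\sum_{m=1}^n\bigl(E(X_m|\mathcal F_{m-1})-X_m\bigr)\ \ge\ \left(b+a\left(\frac{2\sum_{m=1}^nX_m}{n}-1\right)\right)\sqrt n\right)\ \le\ \exp\left(-\frac{2(b^2-a^2)}{\left(1+\frac{4a}{3\sqrt n}\right)^2}\right).$$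
   Context: $E(\cdot|\mathcal F)$ denotes conditional expectation with respect to the $\sigma$-algebra $\mathcal F$. The random variables $X_m$ may be arbitrarily correlated. $\mathcal F_0$ is any $\sigma$-algebra with $\mathcal F_0\subseteq\mathcal F_1$. *)

(* Defs.v *)
(* MathComp / MathComp-Analysis *)
From mathcomp Require Import all_boot all_order all_algebra.
From mathcomp Require Import all_classical all_reals all_analysis.
Import Order.TTheory GRing.Theory Num.Theory.
Import numFieldNormedType.Exports.

Set Implicit Arguments.
Unset Strict Implicit.
Unset Printing Implicit Defensive.

Local Open Scope classical_set_scope.
Local Open Scope ring_scope.

Definition is_filtration (d : measure_display) (T : measurableType d)
    (F : nat -> set (set T)) : Prop :=
  [/\ forall m, sigma_algebra setT (F m),
      forall m, F m `<=` measurable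
    & forall m, F m `<=` F m.+1].

(* Sub-sigma-algebras are plain sets of sets on [T], so that several of them can
   coexist with the ambient measurable structure of [T]; hence measurability
   with respect to [G] is not an instance of [measurable_fun] on [T]. *)
Definition measurable_wrt (T : Type) (R : realType) (G : set (set T))
    (f : T -> R) : Prop :=
  forall B : set R, measurable B -> G (f @^-1` B).

(* [Y] is a version of E(X | G).  Versions are unique only up to a P-null set,
   so conditional expectation is a relation rather than a function. *)
Definition is_cond_expectation (d : measure_display) (T : measurableType d)
    (R : realType) (P : probability T R) (G : set (set T)) (X Y : T -> R)
    : Prop :=
  [/\ measurable_wrt G Y,
      P.-integrable setT (EFin \o Y)
    & forall A, G A ->
        (\int[P]_(t in A) (Y t)%:E = \int[P]_(t in A) (X t)%:E)%E].

(* Main.v *)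
(* Put alpha = a / sqrt n, beta = b / sqrt n, c = 1 + 2 alpha and
   D = 1 + 4 alpha / 3 = (2 c + 1) / 3.  The event is the upper tail
   sum_m (E(X_m | F_(m-1)) - c X_m) >= n (beta - alpha), to which the exponential
   Markov inequality is applied with parameter l = 4 beta / D^2.  Conditioning
   successively on F_(n-1), ..., F_0 and bounding exp by its chord on
   [-l c, 0] reduces the claim to the one-variable inequality
     l x + ln (1 - (1 - e^(-l c)) x) <= (l D - 4 alpha / D)^2 / 8   (0 <= x <= 1).
   With v = l c and m = v / (1 - e^(-v)), it is elementary unless
   m - v < c < m, and then the supremum over x of the left-hand side is
   m / c - 1 - ln (m / c).  For fixed c the difference of the two sides is
   nondecreasing in v, and it is a square at the value of v where m or m - v
   equals c. *)
Require Import Defs.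
From mathcomp Require Import all_boot all_order all_algebra.
From mathcomp Require Import ring lra.
From mathcomp Require Import all_classical all_reals all_analysis.
From mathcomp Require Import measurable_realfun.
Import Order.TTheory GRing.Theory Num.Theory.
Import numFieldNormedType.Exports.
Set Implicit Arguments.
Unset Strict Implicit.
Unset Printing Implicit Defensive.
Local Open Scope classical_set_scope.
Local Open Scope ring_scope.

(** * Exponential inequalities by repeated differentiation *)

Lemma derive_ge0_le (R : realType) (f : R -> R) (a b : R) : a <= b ->
  (forall x : R, a <= x <= b -> exists2 d : R, is_derive x (1 : R) f d & 0 <= d) ->
  f a <= f b.
Proof.
move=> ab df.
have Df (x : R) : a <= x <= b -> derivable f x 1.
  by move=> /df[d dfx _]; exact: (@ex_derive _ _ _ _ _ _ _ dfx).
have [||c] := @MVT_segment R f (fun x => 'D_1 f x) a b ab.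
- move=> x; rewrite in_itv/= => /andP[? ?].
  by apply: DeriveDef => //; apply: Df; rewrite !ltW.
- by apply: derivable_within_continuous => x; rewrite in_itv/=; exact: Df.
rewrite in_itv/= => /df[d dfc d0] fba; rewrite -subr_ge0 fba.
by rewrite (@derive_val _ _ _ _ _ _ _ dfc) mulr_ge0// subr_ge0.
Qed.

(** The [2/2] Pade approximant of exp lies below exp: [p0], [p1], [p2] vanish at 0, each is the
    derivative of the one before, and [p2] has a nonnegative derivative. *)
Lemma pade_expR (R : realType) (v : R) : 0 <= v ->
  12 + 6 * v + v ^+ 2 <= (12 - 6 * v + v ^+ 2) * expR v.
Proof.
move=> v0.
pose p0 (x : R) : R := (12 - 6 * x + x ^+ 2) * expR x - (12 + 6 * x + x ^+ 2).
pose p1 (x : R) : R := (6 - 4 * x + x ^+ 2) * expR x - (6 + 2 * x).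
pose p2 (x : R) : R := (2 - 2 * x + x ^+ 2) * expR x - 2.
have d2 (x : R) : is_derive x (1 : R) p2 (x ^+ 2 * expR x).
  rewrite /p2; apply: is_derive_eq; rewrite /GRing.scale/= ; ring.
have d1 (x : R) : is_derive x (1 : R) p1 (p2 x).
  rewrite /p1 /p2; apply: is_derive_eq; rewrite /GRing.scale/= ; ring.
have d0 (x : R) : is_derive x (1 : R) p0 (p1 x).
  rewrite /p1 /p0; apply: is_derive_eq; rewrite /GRing.scale/= ; ring.
have h2 x : 0 <= x -> 0 <= p2 x.
  move=> x0; rewrite (_ : 0 = p2 0); last by rewrite /p2 expR0; ring.
  apply: (derive_ge0_le (f := p2) x0) => y _; eexists; first exact: d2.
  by rewrite mulr_ge0 ?sqr_ge0 ?expR_ge0.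
have h1 x : 0 <= x -> 0 <= p1 x.
  move=> x0; rewrite (_ : 0 = p1 0); last by rewrite /p1 expR0; ring.
  apply: (derive_ge0_le (f := p1) x0) => y /andP[+ _].
  by exists (p2 y); [exact: d1|exact: h2].
rewrite -subr_ge0 -/(p0 v) (_ : 0 = p0 0); last by rewrite /p0 expR0; ring.
apply: (derive_ge0_le (f := p0) v0) => y /andP[+ _].
by exists (p1 y); [exact: d0|exact: h1].
Qed.

(** Halved, this is the hyperbolic Cusa-Huygens inequality 3 sinh v <= v (2 + cosh v); [r0], [r1],
    [r2] again form a chain of derivatives vanishing at 0. *)
Lemma sinh_cosh_bound (R : realType) (v : R) : 0 <= v ->
  3 * (expR v - expR (- v)) <= 4 * v + v * (expR v + expR (- v)).
Proof.
move=> v0.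
pose r0 (x : R) : R := 4 * x + x * (expR x + expR (- x)) - 3 * (expR x - expR (- x)).
pose r1 (x : R) : R := 4 - 2 * (expR x + expR (- x)) + x * (expR x - expR (- x)).
pose r2 (x : R) : R := x * (expR x + expR (- x)) - (expR x - expR (- x)).
have d2 (x : R) : is_derive x (1 : R) r2 (x * (expR x - expR (- x))).
  rewrite /r2; apply: is_derive_eq; rewrite /GRing.scale/=; ring.
have d1 (x : R) : is_derive x (1 : R) r1 (r2 x).
  rewrite /r1 /r2; apply: is_derive_eq; rewrite /GRing.scale/=; ring.
have d0 (x : R) : is_derive x (1 : R) r0 (r1 x).
  rewrite /r1 /r0; apply: is_derive_eq; rewrite /GRing.scale/=; ring.
have h2 x : 0 <= x -> 0 <= r2 x.
  move=> x0; rewrite (_ : 0 = r2 0); last by rewrite /r2 oppr0 expR0; ring.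
  apply: (derive_ge0_le (f := r2) x0) => y /andP[y0 _]; eexists; first exact: d2.
  by rewrite mulr_ge0// subr_ge0 ler_expR; lra.
have h1 x : 0 <= x -> 0 <= r1 x.
  move=> x0; rewrite (_ : 0 = r1 0); last by rewrite /r1 oppr0 expR0; ring.
  apply: (derive_ge0_le (f := r1) x0) => y /andP[+ _].
  by exists (r2 y); [exact: d1|exact: h2].
rewrite -subr_ge0 -/(r0 v) (_ : 0 = r0 0); last by rewrite /r0 oppr0 expR0; ring.
apply: (derive_ge0_le (f := r0) v0) => y /andP[+ _].
by exists (r1 y); [exact: d0|exact: h1].
Qed.

(** * The function v / (1 - e^(-v)) and the defect of the one-variable inequality *)

(** The generating function of the Todd class; [todd v - v] is v / (e^v - 1). At 0 its value is 0
    and not the limit 1, so it is studied for v > 0 only. *)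
Definition todd (R : realType) (v : R) : R := v / (1 - expR (- v)).

Lemma oneBexpRN_gt0 (R : realType) (v : R) : 0 < v -> 0 < 1 - expR (- v).
Proof. by move=> v0; rewrite subr_gt0 expR_lt1 oppr_lt0. Qed.

Lemma todd_gt0 (R : realType) (v : R) : 0 < v -> 0 < todd v.
Proof. by move=> v0; rewrite divr_gt0// oneBexpRN_gt0. Qed.

(** Multiplication by 12 e^v (1 - e^(-v)) turns this Taylor bound into [pade_expR]. *)
Lemma todd_upper (R : realType) (v : R) : 0 < v ->
  todd v <= 1 + v / 2 + v ^+ 2 / 12.
Proof.
move=> v0; rewrite /todd ler_pdivrMr ?oneBexpRN_gt0// -subr_ge0.
have E0 := expR_gt0 v.
have -> : (1 + v / 2 + v ^+ 2 / 12) * (1 - expR (- v)) - v =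
   ((12 - 6 * v + v ^+ 2) * expR v - (12 + 6 * v + v ^+ 2)) / (12 * expR v).
  by rewrite expRN; field; rewrite gt_eqF.
by rewrite divr_ge0 ?subr_ge0 ?pade_expR ?ltW// mulr_gt0.
Qed.

(** As [todd v - v / 2] is (v/2) coth (v/2), clearing denominators leaves [sinh_cosh_bound] up to a
    positive factor. *)
Lemma todd_lower (R : realType) (v : R) : 0 < v ->
  v ^+ 2 / 12 <= (todd v - v / 2) * (todd v - v / 2 - 1).
Proof.
move=> v0; rewrite /todd -subr_ge0.
have w0 := oneBexpRN_gt0 v0; have E0 := expR_gt0 v.
have E1 : 0 < expR v - 1 by rewrite subr_gt0 expR_gt1.
have -> : (v / (1 - expR (- v)) - v / 2) * (v / (1 - expR (- v)) - v / 2 - 1)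
    - v ^+ 2 / 12 = v * (4 * v + v * (expR v + expR (- v)) -
       3 * (expR v - expR (- v))) * expR v / (6 * (expR v - 1) ^+ 2).
  by rewrite expRN; field; rewrite ?gt_eqF//= ; lra.
apply: divr_ge0; last by rewrite ltW// mulr_gt0// exprn_gt0.
by rewrite !mulr_ge0 ?subr_ge0 ?sinh_cosh_bound ?expR_ge0// ltW.
Qed.

(** The product in [todd_lower] is positive, and its first factor is positive because v < [todd v];
    hence so is the second. *)
Lemma todd_gt (R : realType) (v : R) : 0 < v -> 1 + v / 2 < todd v.
Proof.
move=> v0; have := todd_lower v0; have := todd_gt0 v0.
have : v < todd v.
  by rewrite /todd ltr_pdivlMr ?oneBexpRN_gt0//; have := expR_gt0 (- v); nra.
by move: (todd v) => m; nra.
Qed.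

Lemma derivable_todd (R : realType) (x : R) : 0 < x -> derivable (@todd R) x 1.
Proof.
move=> x0; have w0 : 1 - expR (- x) != 0 by rewrite gt_eqF// oneBexpRN_gt0.
have h : is_derive x (1 : R) (@todd R)
   (1 / (1 - expR (- x)) - x * expR (- x) / (1 - expR (- x)) ^+ 2).
  rewrite /todd; apply: is_derive_eq; rewrite /GRing.scale/=; field; exact: w0.
exact: (@ex_derive _ _ _ _ _ _ _ h).
Qed.

Lemma todd_continuous (R : realType) (a b : R) : 0 < a ->
  {within `[a, b], continuous (@todd R)}.
Proof.
move=> a0; apply: derivable_within_continuous => x; rewrite in_itv/= => /andP[ax _].
exact/derivable_todd/(lt_le_trans a0).
Qed.

(* With [l = v / c], [v * ((2 * c + 1) / (3 * c)) - 6 * (c - 1) / (2 * c + 1)] is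
   [l * D - 4 * alpha / D]; the second term is [todd v / c - 1 - ln (todd v / c)],
   with the logarithm expanded so that it can be differentiated. *)
Definition gap (R : realType) (c v : R) : R :=
  (v * ((2 * c + 1) / (3 * c)) - 6 * (c - 1) / (2 * c + 1)) ^+ 2 / 8
  - (todd v / c - 1 - (ln v - ln (1 - expR (- v)) - ln c)).

Lemma gapE (R : realType) (c v : R) : 0 < c -> 0 < v ->
  gap c v = (v * ((2 * c + 1) / (3 * c)) - 6 * (c - 1) / (2 * c + 1)) ^+ 2 / 8
  - (todd v / c - 1 - ln (todd v / c)).
Proof.
move=> c0 v0; rewrite /gap ln_div ?posrE ?todd_gt0//.
by rewrite /todd ln_div ?posrE ?oneBexpRN_gt0.
Qed.

(** The numerator is grouped by sign: [todd_upper] controls the bracket at [3 * c ^+ 2],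
    [todd_lower] the one at [3 * c], and the last term is a square. *)
Lemma is_derive_gap (R : realType) (c v : R) : 0 < c -> 0 < v ->
  is_derive v (1 : R) (gap c)
   ((3 * c ^+ 2 * (12 + 6 * v + v ^+ 2 - 12 * todd v)
     + 3 * c * (3 * ((2 * todd v - v) * (2 * todd v - v - 2)) - v ^+ 2)
     + v ^+ 2 * (c - 1) ^+ 2) / (36 * (c ^+ 2 * v))).
Proof.
move=> c0 v0; rewrite /gap /todd; have w0 := oneBexpRN_gt0 v0.
have w0' : 1 - expR (- v) != 0 by rewrite gt_eqF.
have dl : is_derive (1 - expR (- v)) (1 : R) (@ln R) (1 - expR (- v))^-1.
  exact: is_derive1_ln.
have dl' := is_derive1_ln v0.
(* These two relations are all that is needed of the coefficients p and q of the square, which can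
   then be made opaque. *)
have pq : c * ((2 * c + 1) / (3 * c) * (6 * (c - 1) / (2 * c + 1))) = 2 * (c - 1).
  by field; rewrite ?gt_eqF//=; lra.
have cp : 3 * (c * ((2 * c + 1) / (3 * c))) = 2 * c + 1 by field; rewrite gt_eqF.
apply: is_derive_eq; rewrite /GRing.scale/= -!exprVn.
(* With w = e^(-v) and k = 1 / (1 - w), the rule k w = k - 1 eliminates the exponential and leaves a
   rational identity. *)
have : (1 - expR (- v))^-1 * expR (- v) = (1 - expR (- v))^-1 - 1 by field.
move: (1 - expR (- v))^-1 => k; move: (expR (- v)) => w kw.
move: pq cp; move: (6 * (c - 1) / (2 * c + 1)) ((2 * c + 1) / (3 * c)).
move=> q p pq cp.
transitivity ((v * p - q) * p / 4 - (k - v * (k * (k * w))) / c + (v^-1 - k * w)).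
  by clear -c0 v0; field; rewrite ?gt_eqF.
rewrite kw.
have cv0 : 36 * (c ^+ 2 * v) != 0 by rewrite gt_eqF// !mulr_gt0// exprn_gt0.
apply: (mulIf cv0); rewrite (divfK cv0).
transitivity (v * (v * (3 * (c * p)) ^+ 2 - 9 * c * (c * (p * q)))
  - 36 * c * v * (k - v * (k * (k - 1))) + 36 * c ^+ 2 * (1 - v * (k - 1))).
  by field; rewrite ?gt_eqF.
by rewrite cp pq; ring.
Qed.

Lemma gap_ndecr (R : realType) (c u v : R) : 0 < c -> 0 < u -> u <= v ->
  gap c u <= gap c v.
Proof.
move=> c0 u0 uv; apply: (derive_ge0_le (f := gap c) uv) => x /andP[ux _].
have x0 := lt_le_trans u0 ux.
eexists; first exact (is_derive_gap c0 x0).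
have h1 : 0 <= 12 + 6 * x + x ^+ 2 - 12 * todd x by have := todd_upper x0; lra.
have h2 : 0 <= 3 * ((2 * todd x - x) * (2 * todd x - x - 2)) - x ^+ 2.
  by have := todd_lower x0; lra.
apply: divr_ge0; last by rewrite !mulr_ge0 ?sqr_ge0// ltW.
have c2 : 0 <= 3 * c ^+ 2 by rewrite mulr_ge0// sqr_ge0.
have c3 : 0 <= 3 * c by rewrite mulr_ge0// ltW.
apply: addr_ge0; last by rewrite mulr_ge0 ?sqr_ge0.
by apply: addr_ge0; apply: mulr_ge0.
Qed.

Lemma gap_todd_eq_ge0 (R : realType) (c v : R) : 0 < c -> 0 < v -> todd v = c ->
  0 <= gap c v.
Proof.
move=> c0 v0 vc; rewrite gapE// vc divff ?gt_eqF// ln1 !subr0 subrr subr0.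
by rewrite divr_ge0// sqr_ge0.
Qed.

(** Here [todd v / c] is e^v, so the subtracted term is e^v - 1 - v = v / c - v; removing it
    reverses the cross term and gives another square. *)
Lemma gap_toddB_eq_ge0 (R : realType) (c v : R) : 0 < c -> 0 < v ->
  todd v - v = c -> 0 <= gap c v.
Proof.
move=> c0 v0 vc; rewrite gapE//.
have tc : todd v / c = expR v.
  have mw : todd v * expR (- v) = c.
    by rewrite -vc /todd; field; rewrite gt_eqF// oneBexpRN_gt0.
  by rewrite -mw expRN invfM invrK mulrA divff ?mul1r// gt_eqF// todd_gt0.
have vE : v / c = expR v - 1.
  have : todd v / c = 1 + v / c by rewrite -{1}(subrK v (todd v)) vc mulrDl divff ?gt_eqF.
  by rewrite tc => ->; ring.
rewrite tc expRK.
have -> : (v * ((2 * c + 1) / (3 * c)) - 6 * (c - 1) / (2 * c + 1)) ^+ 2 / 8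
    = (v * ((2 * c + 1) / (3 * c)) + 6 * (c - 1) / (2 * c + 1)) ^+ 2 / 8
    - (v - v / c).
  by field; rewrite ?gt_eqF//=; lra.
rewrite -vE -addrA [X in _ + X](_ : _ = 0) ?addr0; last by ring.
by rewrite divr_ge0// sqr_ge0.
Qed.

(** For c = 1 the square would occur at 0, outside the domain. Instead [gap 1 x] is at least -x for
    small x > 0, and monotonicity carries this to v as x tends to 0. *)
Lemma gap1_ge0 (R : realType) (v : R) : 0 < v -> 0 <= gap 1 v.
Proof.
move=> v0; apply/ler_addgt0Pl => e e0.
pose x : R := Num.min v (Num.min 1 e).
have x0 : 0 < x by rewrite !lt_min v0 ltr01 e0.
have [xv x1 xe] : [/\ x <= v, x <= 1 & x <= e].
  by split; rewrite !ge_min lexx ?orbT.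
have := gap_ndecr ltr01 x0 xv.
suff : - x <= gap 1 x by lra.
have t1 := todd_gt x0; have t2 := todd_upper x0.
have t0 : 0 < todd x by exact: todd_gt0.
rewrite gapE// divr1 subrr mulr0 mul0r subr0.
(* With m = [todd x], this bounds m - 1 - ln m by (m - 1)^2 / m, which is of second order in x. *)
have lnt : - ln (todd x) <= (todd x)^-1 - 1.
  rewrite -lnV ?posrE//; have := @le_ln1Dx R ((todd x)^-1 - 1).
  by rewrite [1 + _]addrC subrK; apply; rewrite ltrBrDr addNr invr_gt0.
have q0 : 0 <= (x * ((2 * 1 + 1) / (3 * 1))) ^+ 2 / 8 by rewrite divr_ge0// sqr_ge0.
suff : todd x - 1 + ((todd x)^-1 - 1) <= x by lra.
have -> : todd x - 1 + ((todd x)^-1 - 1) = (todd x - 1) ^+ 2 / todd x.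
  by field; rewrite gt_eqF.
have tx : todd x - 1 <= x by nra.
rewrite ler_pdivrMr// expr2 (@le_trans _ _ (x * (todd x - 1)))//.
  by rewrite ler_wpM2r//; lra.
by rewrite ler_wpM2l; lra.
Qed.

(* [gap c] is a square at the point [u <= v] where [todd u = c] (if [c > 1]) or
   [todd u - u = c] (if [c < 1]); for [c = 1] that point degenerates to [u = 0]. *)
Lemma gap_ge0 (R : realType) (c v : R) : 0 < c -> 0 < v ->
  todd v - v <= c <= todd v -> 0 <= gap c v.
Proof.
move=> c0 v0 /andP[cl cu].
have [c1|c1|->] := ltgtP c 1; last exact: gap1_ge0.
(* Left end for the intermediate value theorem: by [todd_gt], [todd e - e] > 1 - e / 2 > 1 - e >=
   c. *)
- pose e : R := Num.min v (1 - c).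
  have e0 : 0 < e by rewrite lt_min v0 subr_gt0.
  have [ev ec] : e <= v /\ e <= 1 - c by split; rewrite ge_min lexx ?orbT.
  have cB : {within `[e, v], continuous (fun x : R => todd x - x)}.
    apply: derivable_within_continuous => x; rewrite in_itv/= => /andP[ex _].
    apply: derivableB; last exact: derivable_id.
    exact/derivable_todd/(lt_le_trans e0).
  have [|u] := IVT ev cB (v := c).
    have := todd_gt e0; rewrite ge_min le_max cl /= orbT => te.
    by apply/orP; left; lra.
  rewrite in_itv/= => /andP[eu uv] uc.
  have u0 := lt_le_trans e0 eu.
  exact: (le_trans (gap_toddB_eq_ge0 c0 u0 uc) (gap_ndecr c0 u0 uv)).
(* Left end again: [todd_upper] and e <= 1 give [todd e] <= 1 + e <= c. *)
- pose e : R := Num.min v (Num.min 1 (c - 1)).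
  have e0 : 0 < e by rewrite !lt_min v0 ltr01 subr_gt0.
  have [ev e1 ec] : [/\ e <= v, e <= 1 & e <= c - 1].
    by split; rewrite !ge_min lexx ?orbT.
  have [|u] := IVT ev (todd_continuous (b := v) e0) (v := c).
    rewrite ge_min le_max cu orbT andbT.
    by have := todd_upper e0 => te; apply/orP; left; nra.
  rewrite in_itv/= => /andP[eu uv] uc.
  have u0 := lt_le_trans e0 eu.
  exact: (le_trans (gap_todd_eq_ge0 c0 u0 uc) (gap_ndecr c0 u0 uv)).
Qed.

(** * The one-variable inequality and the chord of exp *)

(** The logarithm of the left-hand side is concave in x. With m = [todd (l * c)], its maximum on
    [0, 1] is at 0 if m <= c, at 1 if c <= m - l c, and interior otherwise; each case rests on 1 + t
    <= e^t. *)
Lemma bernoulli_mgf_le (R : realType) (c l x : R) : 0 < c -> 0 < l ->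
  0 <= x <= 1 ->
  expR (l * x) * (1 - (1 - expR (- (l * c))) * x) <=
  expR ((l * ((2 * c + 1) / 3) - 6 * (c - 1) / (2 * c + 1)) ^+ 2 / 8).
Proof.
move=> c0 l0 /andP[x0 x1]; set k := (_ ^+ 2 / 8).
have k0 : 0 <= k by rewrite divr_ge0// sqr_ge0.
have v0 : 0 < l * c by rewrite mulr_gt0.
have w0 := oneBexpRN_gt0 v0.
have mE : todd (l * c) * (1 - expR (- (l * c))) = l * c.
  by rewrite /todd divfK// gt_eqF.
have wE : expR (- (l * c)) * expR (l * c) = 1 by rewrite mulrC expRxMexpNx_1.
have [cu|cu] := leP (todd (l * c)) c.
  have lw : l <= 1 - expR (- (l * c)).
    by rewrite -(ler_pM2r c0) -{1}mE mulrC ler_pM2l.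
  apply: (@le_trans _ _ (expR (l * x) * expR (- ((1 - expR (- (l * c))) * x)))).
    by rewrite ler_pM2l ?expR_gt0// expR_ge1Dx.
  rewrite -expRD ler_expR (le_trans _ k0)// -mulrBl.
  by rewrite mulr_le0_ge0// subr_le0.
have [cl|cl] := leP c (todd (l * c) - l * c).
  have lE : expR (l * c) - 1 <= l.
    rewrite -(ler_pM2r c0) -{2}mE.
    have -> : todd (l * c) * (1 - expR (- (l * c))) =
        (expR (l * c) - 1) * (todd (l * c) - l * c).
      have -> : todd (l * c) - l * c = todd (l * c) * expR (- (l * c)).
        by rewrite -{2}mE; ring.
      by rewrite mulrCA mulrBl mul1r (mulrC (expR _)) wE.
    by rewrite ler_wpM2l// subr_ge0 ltW// expR_gt1.
  apply: (@le_trans _ _ (expR (l * x) * (expR (- (l * c)) * expR ((1 - x) * l)))).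
    rewrite ler_pM2l ?expR_gt0//.
    apply: (@le_trans _ _ (expR (- (l * c)) * (1 + (1 - x) * (expR (l * c) - 1)))).
      have -> : expR (- (l * c)) * (1 + (1 - x) * (expR (l * c) - 1)) =
        expR (- (l * c)) * x + (expR (- (l * c)) * expR (l * c)) * (1 - x) by ring.
      by rewrite wE le_eqVlt; apply/orP; left; apply/eqP; ring.
    rewrite ler_pM2l ?expR_gt0// (le_trans _ (expR_ge1Dx _))// lerD2l.
    by rewrite ler_wpM2l// subr_ge0.
  rewrite -!expRD ler_expR -subr_ge0.
  (* The exponent equals l - l c for every x, and subtracting it from k reverses the cross term of
     the square. *)
  have -> : k - (l * x + (- (l * c) + (1 - x) * l)) =
    (l * ((2 * c + 1) / 3) + 6 * (c - 1) / (2 * c + 1)) ^+ 2 / 8.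
    by rewrite /k; field; lra.
  by rewrite divr_ge0// sqr_ge0.
have := gap_ge0 c0 v0; rewrite (ltW cl) (ltW cu) => /(_ isT).
rewrite gapE//.
have -> : l * c * ((2 * c + 1) / (3 * c)) = l * ((2 * c + 1) / 3).
  by field; rewrite gt_eqF.
rewrite -/k subr_ge0 => yk.
have y0 : 0 < todd (l * c) / c by rewrite divr_gt0// todd_gt0.
have yl : todd (l * c) / c * (1 - expR (- (l * c))) = l.
  by rewrite mulrAC mE mulfK// gt_eqF.
move: (todd (l * c) / c) y0 yl yk => y y0 yl yk.
(* The tangent inequality at t = y - l x - 1, with y = m / c, produces a factor e^(-l x) that
   cancels e^(l x) and leaves the exponent y - 1 - ln y. *)
have zy : 1 - (1 - expR (- (l * c))) * x <= expR (y - l * x - 1) * y^-1.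
  rewrite ler_pdivlMr// (le_trans _ (expR_ge1Dx _))// -{2}yl.
  by rewrite le_eqVlt; apply/orP; left; apply/eqP; ring.
have yE : y^-1 = expR (- ln y) by rewrite expRN lnK ?posrE.
rewrite (le_trans (ler_wpM2l (expR_ge0 _) zy))// yE -!expRD ler_expR (le_trans _ yk)//.
by rewrite le_eqVlt; apply/orP; left; apply/eqP; ring.
Qed.

(** The inequality 1 + t <= e^t at t = v x and t = v x - v, multiplied by e^(-v x), is averaged with
    weights 1 - x and x, so that the linear terms cancel. *)
Lemma expR_chord (R : realType) (v x : R) : 0 <= x <= 1 ->
  expR (- (v * x)) <= 1 - (1 - expR (- v)) * x.
Proof.
move=> /andP[x0 x1].
have h1 : expR (- (v * x)) * (1 + v * x) <= 1.
  have := ler_wpM2l (expR_ge0 (- (v * x))) (expR_ge1Dx (v * x)).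
  by rewrite -expRD addNr expR0.
have h2 : expR (- (v * x)) * (1 + (v * x - v)) <= expR (- v).
  have := ler_wpM2l (expR_ge0 (- (v * x))) (expR_ge1Dx (v * x - v)).
  by rewrite -expRD addKr.
have x1' : 0 <= 1 - x by rewrite subr_ge0.
have := lerD (ler_wpM2l x1' h1) (ler_wpM2l x0 h2).
move: (expR (- (v * x))) (expR (- v)) => e w.
have -> : (1 - x) * (e * (1 + v * x)) + x * (e * (1 + (v * x - v))) = e by ring.
by move=> /le_trans; apply; rewrite le_eqVlt; apply/orP; left; apply/eqP; ring.
Qed.

(** * Bounded integrands and conditional expectation *)

(** Makes the closure properties of [measurable_fun] available for [measurable_wrt]. *)
Lemma measurable_wrtP (T : pointedType) (R : realType) (G : set (set T))
    (f : T -> R) : sigma_algebra setT G ->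
  measurable_wrt G f <-> measurable_fun setT (f : g_sigma_algebraType G -> R).
Proof.
move=> sG; split=> [mf _ B mB|mf B mB].
  by rewrite setTI measurable_g_measurableTypeE//; exact: mf.
by have := mf measurableT B mB; rewrite setTI measurable_g_measurableTypeE.
Qed.

Lemma measurable_wrt_measurable (d : measure_display) (T : measurableType d)
    (R : realType) (G : set (set T)) (f : T -> R) : G `<=` measurable ->
  measurable_wrt G f -> measurable_fun setT f.
Proof. by move=> Gm mf _ B mB; rewrite setTI; exact/Gm/mf. Qed.

Lemma bounded_integrable (d : measure_display) (T : measurableType d)
    (R : realType) (P : probability T R) (A : set T) (f : T -> R) (M : R) :
  measurable A -> measurable_fun setT f -> (forall t, `|f t| <= M) ->
  P.-integrable A (EFin \o f).
Proof.
move=> mA mf fM; apply: measurable_bounded_integrable => //.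
- by rewrite (le_lt_trans (probability_le1 P mA))// ltry.
- exact: measurable_funS mf.
exists M; split; first exact: num_real.
by move=> x Mx t _ /=; rewrite (le_trans (fM t))// ltW.
Qed.

Lemma Rintegral_bound (d : measure_display) (T : measurableType d)
    (R : realType) (P : probability T R) (f : T -> R) (M : R) :
  measurable_fun setT f -> (forall t, `|f t| <= M) ->
  `|(\int[P]_t f t)%R| <= M.
Proof.
move=> mf fM; have fi := bounded_integrable P measurableT mf fM.
rewrite (le_trans (le_normr_Rintegral measurableT fi))//.
have -> : M = (\int[P]_(t in setT) (fun=> M) t)%R.
  rewrite (Rintegral_cst P measurableT) -[LHS]mulr1; congr (_ * _).
  exact: (esym (congr1 fine (probability_setT P))).
have M0 : 0 <= M by rewrite (le_trans _ (fM point)).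
apply: le_Rintegral => //.
  apply: (@bounded_integrable _ _ _ _ _ _ M) => //.
    exact: measurableT_comp.
  by move=> t; rewrite normr_id.
by apply: (@bounded_integrable _ _ _ _ _ _ M) => // t; rewrite ger0_norm.
Qed.

(* Splitting [V] as [(M/2) 1_(V >= M/2) + V'] with [0 <= V' <= M/2] halves the
   bound, because the integral of [Z] over the set [V >= M/2] vanishes. *)
Lemma Rintegral_mul_null_bound (d : measure_display) (T : measurableType d)
    (R : realType) (P : probability T R) (G : set (set T)) (Z : T -> R) (C : R) :
  sigma_algebra setT G -> G `<=` measurable -> measurable_fun setT Z ->
  (forall t, `|Z t| <= C) ->
  (forall A, G A -> (\int[P]_(t in A) Z t)%R = 0) ->
  forall (k : nat) (V : T -> R) (M : R), measurable_wrt G V ->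
    (forall t, 0 <= V t <= M) -> `|(\int[P]_t (V t * Z t))%R| <= M * C / 2 ^+ k.
Proof.
move=> sG Gm mZ ZC Z0; elim=> [|k IH] V M mV V01.
  rewrite expr0 divr1; apply: Rintegral_bound.
    by apply: measurable_funM => //; exact: measurable_wrt_measurable mV.
  move=> t; have /andP[v0 vM] := V01 t.
  by rewrite normrM ler_pM// ger0_norm.
pose A := [set t | M / 2 <= V t].
have GA : G A.
  have -> : A = V @^-1` `[M / 2, +oo[.
    by apply/seteqP; split=> t /=; rewrite /A/= in_itv/= andbT.
  exact: mV.
have mA := Gm _ GA.
pose V' t := if M / 2 <= V t then V t - M / 2 else V t.
have mV' : measurable_wrt G V'.
  apply/measurable_wrtP => //; apply: measurable_fun_if => //.
  - by apply: measurable_fun_ler => //; exact/measurable_wrtP.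
  - apply: measurable_funB => //; apply: measurable_funTS.
    exact/measurable_wrtP.
  - by apply: measurable_funTS; exact/measurable_wrtP.
have V'01 t : 0 <= V' t <= M / 2.
  have /andP[v0 vM] := V01 t.
  by rewrite /V'; case: (leP (M / 2)) => ?; apply/andP; split; lra.
have VE : (fun t => V t * Z t) = (fun t => V' t * Z t + M / 2 * (Z \_ A) t).
  apply/funext => t; rewrite patchE /V'.
  have -> : (t \in A) = (M / 2 <= V t) by apply/idP/idP; rewrite inE.
  (* Outside [A] the restriction takes the default value [point], which is 0 in [R]. *)
  by case: ifP => _ /=; [ring|rewrite [point](_ : _ = 0)// mulr0 addr0].
have int1 : P.-integrable setT (EFin \o (fun t => V' t * Z t)).
  apply: (@bounded_integrable _ _ _ _ _ _ (M / 2 * C)) => //.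
    by apply: measurable_funM => //; exact: measurable_wrt_measurable mV'.
  by move=> t; have /andP[v0 vM] := V'01 t; rewrite normrM ler_pM// ger0_norm.
have int2 : P.-integrable setT (EFin \o (Z \_ A)).
  rewrite -restrict_EFin; apply/integrable_restrict => //; rewrite setTI.
  exact: (@bounded_integrable _ _ _ _ _ _ C).
rewrite VE RintegralD//; last exact: (integrableZl measurableT (M / 2) int2).
rewrite RintegralZl// -Rintegral_mkcond Z0// mulr0 addr0.
have := IH V' (M / 2) mV' V'01; congr (_ <= _).
by rewrite exprS; field; rewrite expf_neq0.
Qed.

Lemma le_div_expn2_le0 (R : realType) (a M : R) :
  (forall k : nat, a <= M / 2 ^+ k) -> a <= 0.
Proof.
move=> aM; rewrite leNgt; apply/negP => a0.
pose k := (Num.truncn (M / a)).+1.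
have Mk : M / a < 2 ^+ k.
  rewrite (lt_le_trans (truncnS_gt _))// -natrX ler_nat ltnW// ltn_expl//.
have := aM k; rewrite ler_pdivlMr ?exprn_gt0// leNgt => /negP; apply.
by rewrite mulrC -ltr_pdivrMr.
Qed.

(** Pulling out the known factor: Y - X is bounded by 1 and has zero integral over every set of G,
    so the halving bound holds for all k and the integral of V (Y - X) is 0. *)
Lemma Rintegral_mul_cond_expectation (d : measure_display)
    (T : measurableType d) (R : realType) (P : probability T R)
    (G : set (set T)) (X Y V : T -> R) (M : R) :
  sigma_algebra setT G -> G `<=` measurable ->
  measurable_fun setT X -> measurable_fun setT Y ->
  (forall t, 0 <= X t <= 1) -> (forall t, 0 <= Y t <= 1) ->
  (forall A, G A -> (\int[P]_(t in A) Y t = \int[P]_(t in A) X t)%R) ->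
  measurable_wrt G V -> (forall t, 0 <= V t <= M) ->
  (\int[P]_t (V t * Y t) = \int[P]_t (V t * X t))%R.
Proof.
move=> sG Gm mX mY X01 Y01 XY mV V0M.
have bnd (W : T -> R) : (forall t, 0 <= W t <= 1) -> forall t, `|W t| <= 1.
  by move=> W01 t; have /andP[w0 w1] := W01 t; rewrite ger0_norm.
have intW (W : T -> R) (A : set T) : measurable A -> measurable_fun setT W ->
    (forall t, 0 <= W t <= 1) -> P.-integrable A (EFin \o W).
  by move=> mA mW W01; exact: (@bounded_integrable _ _ _ _ _ _ 1 _ _ (bnd _ W01)).
have intVW (W : T -> R) : measurable_fun setT W -> (forall t, 0 <= W t <= 1) ->
    P.-integrable setT (EFin \o (fun t => V t * W t)).
  move=> mW W01; apply: (@bounded_integrable _ _ _ _ _ _ M) => //.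
    by apply: measurable_funM => //; exact: measurable_wrt_measurable mV.
  move=> t; have /andP[v0 vM] := V0M t; have /andP[w0 w1] := W01 t.
  by rewrite ger0_norm ?mulr_ge0// -(mulr1 M) ler_pM.
apply/eqP; rewrite -subr_eq0 -normr_le0 -RintegralB//; try exact: intVW.
have -> : (fun t => V t * Y t - V t * X t) = (fun t => V t * (Y t - X t)).
  by apply/funext => t; rewrite mulrBr.
apply: (@le_div_expn2_le0 _ _ (M * 1)) => k.
apply: (Rintegral_mul_null_bound sG) V0M => //.
- exact: (measurable_funB mY mX).
- move=> t; have /andP[x0 x1] := X01 t; have /andP[y0 y1] := Y01 t.
  by rewrite ler_norml; apply/andP; split; lra.
- move=> A GA; have mA := Gm _ GA.
  by rewrite RintegralB ?XY ?subrr//; exact: intW.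
Qed.

(** The integral over the set where W < 0 is also at most 0, hence zero, so this set is null. *)
Lemma ae_ge0 (d : measure_display) (T : measurableType d) (R : realType)
    (P : probability T R) (W : T -> R) : P.-integrable setT (EFin \o W) ->
  (0 <= \int[P]_(t in [set t | (W t < 0)%R]) (W t)%:E)%E ->
  {ae P, forall t, 0 <= W t}.
Proof.
move=> iW; set A := [set t | _] => W0.
have mW : measurable_fun setT W by apply/measurable_EFinP; exact: measurable_int iW.
have mA : measurable A.
  have -> : A = W @^-1` `]-oo, 0[ by apply/seteqP; split=> t /=; rewrite in_itv.
  by rewrite -[X in measurable X]setTI; exact: mW.
have : (\int[P]_(t in A) `|(W t)%:E| = 0)%E.
  apply/eqP; rewrite eq_le integral_ge0 ?andbT//.
  rewrite (eq_integral (fun t => - (W t)%:E)%E); last first.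
    by move=> t; rewrite inE => At; rewrite abse_EFin ltr0_norm.
  have iA : P.-integrable A (EFin \o W) by exact: integrableS iW.
  rewrite integralN/=; first by rewrite leeNl oppe0.
  exact: integrable_add_def.
move/ae_eq_integral_abs => /(_ mA) [|N [mN PN AN]].
  by apply/measurable_EFinP; exact: measurable_funTS.
exists N; split => // t /= /negP; rewrite -ltNge => Wt; apply: AN => /= h.
by have := h Wt => -[] Wt0; rewrite Wt0 ltxx in Wt.
Qed.

(** The sets where Y < 0 and where Y > 1 lie in G, so on them the integral of Y can be replaced by
    that of X; [ae_ge0] then applies to Y and 1 - Y. *)
Lemma cond_expectation_ae01 (d : measure_display) (T : measurableType d)
    (R : realType) (P : probability T R) (G : set (set T)) (X Y : T -> R) :
  sigma_algebra setT G -> G `<=` measurable -> measurable_fun setT X ->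
  (forall t, 0 <= X t <= 1) -> is_cond_expectation P G X Y ->
  {ae P, forall t, 0 <= Y t <= 1}.
Proof.
move=> sG Gm mX X01 [mY iY XY].
have iX : P.-integrable setT (EFin \o X).
  apply: (@bounded_integrable _ _ _ _ _ _ 1) => // t.
  by have /andP[x0 x1] := X01 t; rewrite ger0_norm.
have lo : {ae P, forall t, 0 <= Y t}.
  apply: ae_ge0 => //; rewrite XY; last first.
    have -> : [set t | Y t < 0] = Y @^-1` `]-oo, 0[.
      by apply/seteqP; split=> t /=; rewrite in_itv.
    exact: mY.
  by apply: integral_ge0 => t _; rewrite lee_fin; case/andP: (X01 t).
have hi : {ae P, forall t, 0 <= 1 - Y t}.
  have i1 (A : set T) : measurable A -> P.-integrable A (EFin \o fun=> 1).
    by move=> mA; apply: (@bounded_integrable _ _ _ _ _ _ 1) => // t; rewrite normr1.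
  apply: ae_ge0; first exact: (integrableB measurableT (i1 _ measurableT) iY).
  have -> : [set t | 1 - Y t < 0] = Y @^-1` `]1, +oo[.
    by apply/seteqP; split=> t /=; rewrite in_itv/= andbT subr_lt0.
  set A := _ @^-1` _; have GA : G A by exact: mY.
  have mA := Gm _ GA.
  have iYA : P.-integrable A (EFin \o Y) by exact: integrableS iY.
  have iXA : P.-integrable A (EFin \o X) by exact: integrableS iX.
  rewrite (integralB_EFin mA (i1 _ mA) iYA) XY//.
  rewrite -(integralB_EFin mA (i1 _ mA) iXA).
  by apply: integral_ge0 => t _; rewrite lee_fin subr_ge0; case/andP: (X01 t).
by apply: filterS2 lo hi => t y0; rewrite subr_ge0 y0.
Qed.

(** * Exponential moments along the filtration *)

(** The chord bound makes the integrand affine in X with a G-measurable weight, so X can be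
    exchanged for Y; the bound by K is then used pointwise at x = Y t. *)
Lemma Rintegral_exp_step_le (d : measure_display)
    (T : measurableType d) (R : realType) (P : probability T R)
    (G : set (set T)) (X Y V : T -> R) (M c l K : R) :
  sigma_algebra setT G -> G `<=` measurable ->
  measurable_fun setT X -> measurable_wrt G Y ->
  (forall t, 0 <= X t <= 1) -> (forall t, 0 <= Y t <= 1) ->
  (forall A, G A -> (\int[P]_(t in A) Y t = \int[P]_(t in A) X t)%R) ->
  measurable_wrt G V -> (forall t, 0 <= V t <= M) -> 0 <= c -> 0 <= l ->
  (forall x, 0 <= x <= 1 ->
    expR (l * x) * (1 - (1 - expR (- (l * c))) * x) <= K) ->
  (\int[P]_t (V t * expR (l * (Y t - c * X t))) <= K * \int[P]_t V t)%R.
Proof.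
move=> sG Gm mX mGY X01 Y01 XY mGV V0M c0 l0 HK.
have mY := measurable_wrt_measurable Gm mGY.
have mV := measurable_wrt_measurable Gm mGV.
have bi (f : T -> R) (N : R) : measurable_fun setT f ->
    (forall t, 0 <= f t <= N) -> P.-integrable setT (EFin \o f).
  move=> mf f0N; apply: (@bounded_integrable _ _ _ _ _ _ N) => // t.
  by have /andP[f0 fN] := f0N t; rewrite ger0_norm.
(* The factor e^(l Y) is G-measurable as well and joins the weight. *)
pose U t := V t * expR (l * Y t).
have mGU : measurable_wrt G U.
  apply/measurable_wrtP => //; apply: measurable_funM; first exact/measurable_wrtP.
  apply: measurableT_comp => //; apply: measurable_funM => //.
  exact/measurable_wrtP.
have mU := measurable_wrt_measurable Gm mGU.
have U0 t : 0 <= U t <= M * expR l.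
  have /andP[v0 vM] := V0M t; have /andP[y0 y1] := Y01 t.
  rewrite mulr_ge0 ?expR_ge0//= ler_pM ?expR_ge0// ler_expR.
  by rewrite -[leRHS]mulr1 ler_wpM2l.
have UW (W : T -> R) : measurable_fun setT W -> (forall t, 0 <= W t <= 1) ->
    P.-integrable setT (EFin \o (fun t => U t * W t)).
  move=> mW W01; apply: (bi _ (M * expR l)); first exact: measurable_funM.
  move=> t; have /andP[u0 uM] := U0 t; have /andP[w0 w1] := W01 t.
  by rewrite mulr_ge0//= -[leRHS]mulr1 ler_pM.
have iU := bi U _ mU U0.
pose q := 1 - expR (- (l * c)).
have split W : P.-integrable setT (EFin \o (fun t => U t * W t)) ->
   (\int[P]_t (U t - q * (U t * W t)) = \int[P]_t U t - q * \int[P]_t (U t * W t))%R.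
  move=> iUW; rewrite RintegralB// ?RintegralZl//.
  exact: (integrableZl measurableT q iUW).
have isplit W : P.-integrable setT (EFin \o (fun t => U t * W t)) ->
    P.-integrable setT (EFin \o (fun t => U t - q * (U t * W t))).
  move=> iUW; exact: (integrableB measurableT iU (integrableZl measurableT q iUW)).
apply: (@le_trans _ _ (\int[P]_t (U t - q * (U t * X t)))%R).
  apply: le_Rintegral => //.
  - apply: (bi _ (M * expR l)).
      apply: measurable_funM => //; apply: measurableT_comp => //.
      apply: measurable_funM => //; apply: measurable_funB => //.
      exact: measurable_funM.
    move=> t; have /andP[v0 vM] := V0M t; have /andP[y0 y1] := Y01 t.
    have /andP[x0 x1] := X01 t.
    rewrite mulr_ge0 ?expR_ge0//= ler_pM ?expR_ge0// ler_expR.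
    by rewrite -[leRHS]mulr1 ler_wpM2l//; nra.
  - exact/isplit/UW.
  - move=> t _; have /andP[v0 vM] := V0M t.
    have -> : U t - q * (U t * X t) = V t * (expR (l * Y t) * (1 - q * X t)).
      by rewrite /U; ring.
    rewrite ler_wpM2l// mulrBr expRD ler_wpM2l ?expR_ge0// mulrA.
    exact: expR_chord.
rewrite (split X) ?UW//.
rewrite -(Rintegral_mul_cond_expectation sG Gm mX mY X01 Y01 XY mGU U0).
rewrite -(split Y) ?UW//.
have iV := bi V _ mV V0M.
rewrite -(RintegralZl K measurableT iV).
apply: le_Rintegral => //.
- exact/isplit/UW.
- exact: (integrableZl measurableT K iV).
move=> t _; have /andP[v0 vM] := V0M t.
have -> : U t - q * (U t * Y t) = V t * (expR (l * Y t) * (1 - q * Y t)).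
  by rewrite /U; ring.
by rewrite (mulrC K) ler_wpM2l// HK.
Qed.

Lemma filtration_le (d : measure_display) (T : measurableType d)
    (F : nat -> set (set T)) : is_filtration F ->
  forall i j, (i <= j)%N -> F i `<=` F j.
Proof.
move=> [_ _ Fs] i j /subnK <-; elim: (j - i)%N => // k IH A /IH.
exact: Fs.
Qed.

(** Induction on k, splitting off the last term: the exponential of the first k terms is the weight,
    and [Y k.+1] is measurable for [F k] thanks to the shift [m.-1]. *)
Lemma Rintegral_exp_sum_le (d : measure_display)
    (T : measurableType d) (R : realType) (P : probability T R)
    (F : nat -> set (set T)) (X Y : nat -> T -> R) (c l K : R) :
  is_filtration F ->
  (forall m, (1 <= m)%N -> measurable_wrt (F m) (X m)) ->
  (forall m, (1 <= m)%N -> measurable_wrt (F m.-1) (Y m)) ->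
  (forall m, (1 <= m)%N -> forall t, 0 <= X m t <= 1) ->
  (forall m, (1 <= m)%N -> forall t, 0 <= Y m t <= 1) ->
  (forall m, (1 <= m)%N -> forall A, F m.-1 A ->
    (\int[P]_(t in A) Y m t = \int[P]_(t in A) X m t)%R) ->
  0 <= c -> 0 <= l ->
  (forall x, 0 <= x <= 1 ->
    expR (l * x) * (1 - (1 - expR (- (l * c))) * x) <= K) ->
  forall k, (\int[P]_t expR (l * \sum_(1 <= m < k.+1) (Y m t - c * X m t))
              <= K ^+ k)%R.
Proof.
move=> hF mX mY X01 Y01 XY c0 l0 HK.
have [sF Fm Fs] := hF.
pose S k t := \sum_(1 <= m < k.+1) (Y m t - c * X m t).
have SS k : S k.+1 = (fun t => S k t + (Y k.+1 t - c * X k.+1 t)).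
  by apply/funext => t; rewrite /S big_nat_recr.
have S0 t : S 0%N t = 0 by rewrite /S big_geq.
(* At x = 0 the assumption on K reads 1 <= K. *)
have K0 : 0 <= K.
  have := HK 0; rewrite lexx ler01 !mulr0 expR0 subr0 mulr1 => /(_ isT).
  exact: le_trans.
have mS k : measurable_wrt (F k) (S k).
  elim: k => [|k IH].
    apply/measurable_wrtP => //; rewrite (_ : S 0%N = cst 0) //.
    by apply/funext => t; rewrite S0.
  rewrite SS; apply/measurable_wrtP => //; apply: measurable_funD.
    by apply/measurable_wrtP => // B mB; exact/Fs/IH.
  apply: measurable_funB.
    by apply/measurable_wrtP => // B mB; exact/Fs/(mY k.+1 isT).
  by apply: measurable_funM => //; apply/measurable_wrtP => //; exact: mX.
(* Bounds the weight e^(l S), as the conditioning step requires. *)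
have Sk k t : S k t <= k%:R.
  elim: k => [|k IH]; first by rewrite S0.
  rewrite SS -natr1 lerD//.
  have /andP[_ y1] := Y01 k.+1 isT t; have /andP[x0 _] := X01 k.+1 isT t.
  by rewrite (le_trans _ y1)// gerBl mulr_ge0.
elim=> [|k IH].
  rewrite expr0 (_ : (fun _ => _) = cst 1); last first.
    by apply/funext => t; rewrite -/(S 0%N t) S0 mulr0 expR0.
  rewrite (Rintegral_cst P measurableT) mul1r.
  by rewrite le_eqVlt; apply/orP; left; apply/eqP; exact: (congr1 fine (probability_setT P)).
have mXm : measurable_fun setT (X k.+1).
  by apply: (measurable_wrt_measurable (Fm k.+1)); exact: mX.
pose V t := expR (l * S k t).
have mV : measurable_wrt (F k) V.
  apply/measurable_wrtP => //; apply: measurableT_comp => //.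
  by apply: measurable_funM => //; exact/measurable_wrtP.
have V0 t : 0 <= V t <= expR (l * k%:R).
  by rewrite expR_ge0 /= ler_expR ler_wpM2l.
have := Rintegral_exp_step_le (sF k) (Fm k) mXm (mY k.+1 isT) (X01 k.+1 isT)
  (Y01 k.+1 isT) (XY k.+1 isT) mV V0 c0 l0 HK.
rewrite [X in (X <= _)%R](_ : _ = \int[P]_t expR (l * S k.+1 t))%R; last first.
  by apply: eq_Rintegral => t _; rewrite SS -expRD -mulrDr.
move=> /le_trans; apply; rewrite exprS ler_wpM2l//; exact: IH.
Qed.

(** * The exponential Markov inequality and the tail bound *)

(** The bound M makes the exponential moment finite, so Chernoff's inequality can be stated with a
    real integral. *)
Lemma prob_ge_le_Rintegral_expR (d : measure_display) (T : measurableType d)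
    (R : realType) (P : probability T R) (S : T -> R) (l r M : R) : 0 < l ->
  measurable_fun setT S -> (forall t, S t <= M) ->
  (P [set t | (r <= S t)%R] <=
    (expR (- (l * r)) * \int[P]_t expR (l * S t))%R%:E)%E.
Proof.
move=> l0 mS SM.
pose S' : {RV P >-> R} := mfun_Sub (mem_set mS).
have iS : P.-integrable setT (EFin \o (fun t => expR (l * S t))).
  apply: (@bounded_integrable _ _ _ _ _ _ (expR (l * M))) => //.
    by apply: measurableT_comp => //; exact: measurable_funM.
  by move=> t; rewrite ger0_norm ?expR_ge0// ler_expR ler_wpM2l// ltW.
rewrite (le_trans (chernoff S' r l0))// EFinM muleC lee_pmul2l ?lte_fin ?expR_gt0//.
rewrite fineK; last exact: integrable_fin_num.
rewrite /mmt_gen_fun unlock le_eqVlt; apply/orP; left; apply/eqP.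
by apply: eq_integral => t _ /=; rewrite mulrC.
Qed.

Lemma measurable_sum_nat (d : measure_display) (T : measurableType d)
    (R : realType) (f : nat -> T -> R) (n : nat) :
  (forall m, (1 <= m)%N -> measurable_fun setT (f m)) ->
  measurable_fun setT (fun t => \sum_(1 <= m < n.+1) f m t).
Proof.
move=> mf; elim: n => [|n IH].
  by rewrite (_ : (fun _ => _) = cst 0)//; apply/funext => t; rewrite big_geq.
rewrite (_ : (fun _ => _) =
  (fun t => \sum_(1 <= m < n.+1) f m t) \+ f n.+1).
  by apply: measurable_funD => //; exact: mf.
by apply/funext => t /=; rewrite big_nat_recr.
Qed.

Theorem theorem1 (d : measure_display) (T : measurableType d) (R : realType)
    (P : probability T R)
    (X : nat -> {RV P >-> R}) (F : nat -> set (set T)) (EX : nat -> T -> R)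
    (hF : is_filtration F)
    (hXF : forall m' m : nat, (1 <= m' <= m)%N -> measurable_wrt (F m) (X m'))
    (hX01 : forall m : nat, (1 <= m)%N -> forall t : T, 0 <= X m t <= 1)
    (hEX : forall m : nat, (1 <= m)%N ->
      is_cond_expectation P (F m.-1) (X m) (EX m))
    (n : nat) (hn : (1 <= n)%N)
    (a : R) (ha : 1 + 4 * a / (3 * Num.sqrt n%:R) != 0)
    (b : R) (hb : 0 <= b) :
  (P [set t | (\sum_(1 <= m < n.+1) (EX m t - X m t)
              >= (b + a * (2 * (\sum_(1 <= m < n.+1) X m t) / n%:R - 1))
                 * Num.sqrt n%:R)%R]
   <= (expR (- (2 * (b ^+ 2 - a ^+ 2)
                / (1 + 4 * a / (3 * Num.sqrt n%:R)) ^+ 2)))%:E)%E.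
Proof.
have [sF Fm Fs] := hF.
have mX m : measurable_fun setT (X m) by [].
have mEX m : (1 <= m)%N -> measurable_fun setT (EX m).
  by move=> m1; have [mE _ _] := hEX m m1; exact: measurable_wrt_measurable mE.
pose s : R := Num.sqrt n%:R.
have n0 : 0 < n%:R :> R by rewrite ltr0n.
have s0 : 0 < s by rewrite sqrtr_gt0.
have ss : s ^+ 2 = n%:R by rewrite sqr_sqrtr// ltW.
rewrite -/s; set ev := [set t | _].
have mev : measurable ev.
  rewrite -[ev]setTI; apply: measurable_fun_le => //.
    apply: measurable_funM => //; apply: measurable_funD => //.
    apply: measurable_funM => //; apply: measurable_funB => //.
    apply: measurable_funM => //; apply: measurable_funM => //.
    exact: (measurable_sum_nat (f := X)).
  apply: (measurable_sum_nat (f := fun m t => EX m t - X m t)) => m m1.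
  by apply: measurable_funB => //; exact: mEX.
(* If b^2 <= a^2, the right-hand side is at least 1. *)
have [ba|ab] := leP (b ^+ 2) (a ^+ 2).
  rewrite (le_trans (probability_le1 P mev))// lee_fin -expR0 ler_expR oppr_ge0.
  rewrite mulr_le0_ge0 ?invr_ge0 ?sqr_ge0// mulr_ge0_le0// subr_le0//.
pose al := a / s; pose be := b / s; pose c := 1 + 2 * al.
(* A version of the conditional expectation lies in [0, 1] only almost surely; clipping it gives
   pointwise bounds. *)
pose Y m t := Num.min 1 (Num.max 0 (EX m t)).
have Y01 m t : 0 <= Y m t <= 1.
  by rewrite /Y le_min ler01 le_max lexx/= ge_min lexx.
have EXY : {ae P, forall t, forall m, (1 <= m)%N -> EX m t = Y m t}.
  apply/ae_foralln => m; case: m => [|m]; first exact: aeW.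
  have := cond_expectation_ae01 (sF m) (Fm m) (mX m.+1) (hX01 m.+1 isT) (hEX m.+1 isT).
  apply: filterS => t /andP[e0 e1] _.
  by rewrite /Y (max_idPr e0) (min_idPr e1).
pose E' := [set t | (be - al) * n%:R <= \sum_(1 <= m < n.+1) (Y m t - c * X m t)].
have mY m : (1 <= m)%N -> measurable_fun setT (Y m).
  move=> m1; apply: measurable_minr => //; apply: measurable_maxr => //.
  exact: mEX.
have mS : measurable_fun setT
    (fun t => \sum_(1 <= m < n.+1) (Y m t - c * X m t)).
  apply: (measurable_sum_nat (f := fun m t => Y m t - c * X m t)) => m m1.
  by apply: measurable_funB; [exact: mY|exact: measurable_funM].
have mE' : measurable E'.
  by rewrite -[E']setTI; apply: measurable_fun_le.
have evE : (P ev <= P E')%E.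
  have [N [mN PN NE]] := EXY.
  have evN : ev `<=` E' `|` N.
    move=> t evt; have [Nt|Nt] := pselect (N t); [by right|left].
    have Yt : forall m, (1 <= m)%N -> EX m t = Y m t.
      by apply: contrapT => nY; apply: Nt; apply: NE.
    rewrite /E'/=.
    have -> : \sum_(1 <= m < n.+1) (Y m t - c * X m t) =
      \sum_(1 <= m < n.+1) (EX m t - X m t)
      - 2 * al * \sum_(1 <= m < n.+1) X m t.
      rewrite mulr_sumr -sumrB; apply: eq_big_nat => m /andP[m1 _].
      by rewrite Yt// /c; ring.
    move: evt; rewrite /ev/=.
    move: (\sum_(1 <= m < n.+1) X m t) (\sum_(1 <= m < n.+1) (EX m t - X m t)).
    move=> x y; rewrite lerBrDr; apply: le_trans.
    rewrite le_eqVlt; apply/orP; left; apply/eqP.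
    by rewrite /be /al -ss; field; rewrite gt_eqF.
  rewrite (le_trans (le_measure P _ _ evN)) ?inE//; first exact: measurableU.
  rewrite (le_trans (measureU2 P mE' mN))// [X in (_ + X)%E](_ : _ = 0%E) ?adde0//.
apply: (le_trans evE).
have b0 : 0 < b.
  rewrite lt_neqAle hb andbT; apply/eqP => b0.
  by move: ab; rewrite -b0 expr0n/= ltNge sqr_ge0.
have [alb nalb] : al < be /\ - al < be.
  have [nab an] : - a < b /\ a < b by split; nra.
  by rewrite /al /be -mulNr !ltr_pM2r ?invr_gt0.
(* If c <= 0, each summand is at most 1 - c = -2 al < be - al, so the threshold is never reached. *)
have [c0|c0] := leP c 0.
  rewrite (_ : E' = set0) ?measure0 ?lee_fin ?expR_ge0//.
  apply/seteqP; split=> // t; rewrite /E'/= leNgt => /negP; apply.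
  apply: (@le_lt_trans _ _ (\sum_(1 <= m < n.+1) (1 - c))).
    apply: ler_sum_nat => m /andP[m1 _].
    have /andP[_ y1] := Y01 m t; have /andP[x0 x1] := hX01 m m1 t.
    by rewrite lerB//; nra.
  rewrite sumr_const_nat subn1/= -[X in X < _]mulr_natr ltr_pM2r// /c; lra.
pose D := (2 * c + 1) / 3.
have D0 : 0 < D by rewrite divr_gt0//; lra.
(* The minimizer over l of (l D - 4 al / D)^2 / 8 - l (be - al). *)
pose l := 4 * be / D ^+ 2.
have l0 : 0 < l by rewrite divr_gt0 ?exprn_gt0// mulr_gt0// divr_gt0.
pose k := (l * ((2 * c + 1) / 3) - 6 * (c - 1) / (2 * c + 1)) ^+ 2 / 8.
have HK x : 0 <= x <= 1 -> expR (l * x) * (1 - (1 - expR (- (l * c))) * x) <= expR k.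
  exact: bernoulli_mgf_le.
have I : (\int[P]_t expR (l * \sum_(1 <= m < n.+1) (Y m t - c * X m t))
            <= expR k ^+ n)%R.
  apply: (Rintegral_exp_sum_le hF) => //; try exact: ltW.
  - by move=> m m1; apply: hXF; rewrite m1 leqnn.
  - move=> m m1; have [mE _ _] := hEX m m1.
    apply/measurable_wrtP => //; apply: measurable_minr => //.
    by apply: measurable_maxr => //; exact/measurable_wrtP.
  (* Clipping changes [EX m] on a null set only, so its integrals are unchanged. *)
  - move=> m m1 A FA; have [mE iE EE] := hEX m m1.
    rewrite /Rintegral -(EE A FA); congr fine.
    have mA := Fm _ _ FA.
    apply: ae_eq_integral => //.
    - by apply/measurable_EFinP/measurable_funTS; exact: mY.
    - by apply/measurable_EFinP/measurable_funTS; exact: mEX.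
    - by apply: filterS EXY => t EYt _ /=; rewrite EYt.
(* At this l the value of k is 2 (be - al)^2 / D^2, so each of the n terms contributes -2 (be^2 -
   al^2) / D^2 to the exponent. *)
have -> : expR (- (2 * (b ^+ 2 - a ^+ 2) / (1 + 4 * a / (3 * s)) ^+ 2)) =
   expR (- (l * ((be - al) * n%:R))) * expR k ^+ n.
  rewrite -expRM_natl -expRD; congr expR.
  have -> : a = al * s by rewrite /al divfK// gt_eqF.
  have -> : b = be * s by rewrite /be divfK// gt_eqF.
  rewrite /k /l /D -ss /c.
  have al3 : 2 * (1 + 2 * al) + 1 != 0 by rewrite -/c gt_eqF//; lra.
  by field; rewrite al3 gt_eqF.
apply: (le_trans (@prob_ge_le_Rintegral_expR _ _ _ P _ l _ n%:R l0 mS _)).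
  move=> t; rewrite [leRHS](_ : _ = \sum_(1 <= m < n.+1) 1); last first.
    by rewrite sumr_const_nat subn1.
  apply: ler_sum_nat => m /andP[m1 _].
  have /andP[_ y1] := Y01 m t; have /andP[x0 _] := hX01 m m1 t.
  by rewrite (le_trans _ y1)// gerBl mulr_ge0// ltW.
by rewrite lee_fin ler_wpM2l ?expR_ge0.
Qed.
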